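(* Let $N$ be a spherical bipartite network with equatorial vertices $1,\dots,n$, all black. Let $X^+=X(N\cap H^+)\in\mathrm{Gr}(k_1,n)$ and $X^-=X(N\cap H^-)\in\mathrm{Gr}(k_2,n)$ be the points represented by the upper and lower planar bipartite networks. Then $k=k_1+k_2$ and $$X(N)=\bigoplus(X^+,X^-)\in\mathrm{Gr}(k,n)\cup\{0\},$$ where $X(N)=0$ means that $\Delta_I(N)=0$ for all $I$.
   Context: Let $S^2$ be the two-sphere, $H$ the equator, $H^\pm$ the closed upper and lower hemispheres. A spherical bipartite network is a weighted bipartite (black/white) graph $N$ embedded in $S^2$ with distinguished vertices $1,\dots,n$ arranged in order on $H$, with $N\cap H$ consisting only of these vertices, such that $N\cap H^+$ and $N\cap H^-$ are planar bipartite networks in the disks $H^\pm$ with boundary vertices $1,\dots,n$ (each of degree $1$ in each network, joined to interior vertices). All vertices on $H$ are assumed black. Let $k=\#\{\text{white vertices of }N\setminus H\}-\#\{\text{black vertices of }N\setminus H\}$. An almost perfect matching $\Pi$ of $N$ is a set of edges using each vertex of $N\setminus H$ exactly once and each equatorial vertex at most once; $I(\Pi)$ is the set of used equatorial vertices, $I^\pm(\Pi)$ those matched by an edge in $H^\pm$. The equatorial measurements are $\Delta_I(N)=\sum_{I(\Pi)=I}(-1)^{\mathrm{inv}(I^+(\Pi),I^-(\Pi))}\mathrm{wt}(\Pi)$ for $|I|=k$, where $\mathrm{inv}(A,B)=\#\{(a,b)\in A\times B:a>b\}$ and $\mathrm{wt}$ is the product of edge weights. $X(N)$ is the vector $(\Delta_I(N))_I$,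 regarded (when nonzero) as a point in Plücker coordinates. For the planar networks $N\cap H^\pm$ (all boundary vertices black), an almost perfect matching uses each interior vertex exactly once and each boundary vertex at most once; the points $X(N\cap H^\pm)$ have Plücker coordinates $\Delta_I=\sum\mathrm{wt}(\Pi)$ over almost perfect matchings $\Pi$ whose set of used boundary vertices is $I$; these are assumed not all zero, so that $X^\pm$ are defined. The direct sum map $\bigoplus$ sends $(X,K)\in\mathrm{Gr}(k_1,n)\times\mathrm{Gr}(k_2,n)$ to $X+K=\mathrm{span}(X,K)$, with value $0$ if $\dim(X+K)<k_1+k_2$; in Plücker coordinates $\Delta_I(\bigoplus(X,K))=\sum_{J\subset I,\,|J|=k_1}(-1)^{\mathrm{inv}(J,I\setminus J)}\Delta_J(X)\Delta_{I\setminus J}(K)$. *)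

(* Defs.v *)
From HB Require Import structures.
From mathcomp Require Import all_boot all_order all_algebra.
From mathcomp Require Import all_classical all_reals all_analysis.
Set Implicit Arguments.
Unset Strict Implicit.
Unset Printing Implicit Defensive.
Import Order.TTheory GRing.Theory Num.Theory.
Import numFieldNormedType.Exports.
Local Open Scope ring_scope.

(** * The sphere *)

Section Sphere.
Variable R : realType.
Implicit Types p : R * R * R.

Definition sphere2 : set (R * R * R) :=
  [set p | p.1.1 ^+ 2 + p.1.2 ^+ 2 + p.2 ^+ 2 = 1]%classic.

Definition equator : set (R * R * R) :=
  [set p | sphere2 p /\ p.2 = 0]%classic.

(* [true] is the closed upper hemisphere, [false] the closed lower one. *)
Definition hemisphere (s : bool) : set (R * R * R) :=
  [set p | sphere2 p /\ (if s then 0 <= p.2 else p.2 <= 0)]%classic.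

End Sphere.

(** * Drawn bipartite networks *)

(* A weighted bipartite multigraph with [n] distinguished vertices, together
   with the data of a drawing: a point for each vertex and, for each edge, a
   path parametrised by [0, 1] from its black end to its white end.  The
   conditions on these data are in [spherical_network] below.  The weights lie
   in an arbitrary field [F], unrelated to the coordinates of the sphere. *)
Record network (R : realType) (F : fieldType) (n : nat) := Network {
  vertex : finType;
  edge : finType;
  black : pred vertex;
  black_end : edge -> vertex;
  white_end : edge -> vertex;
  weight : edge -> F;
  equatorial : 'I_n -> vertex;
  vertex_pos : vertex -> R * R * R;
  edge_path : edge -> R -> R * R * R
}.

Section Network.
Variables (R : realType) (F : fieldType) (n : nat) (N : network R F n).

Definition incident (v : vertex N) (e : edge N) : bool :=
  (black_end e == v) || (white_end e == v).

Definition interior_vertex (v : vertex N) : bool :=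
  v \notin codom (@equatorial _ _ _ N).

Definition drawn_set : set (R * R * R) :=
  [set p | (exists v : vertex N, p = vertex_pos v) \/
           (exists (e : edge N) (t : R),
              0 <= t <= 1 /\ p = edge_path e t)]%classic.

Definition edge_in (s : bool) (e : edge N) : bool :=
  `[< forall t : R, 0 <= t <= 1 -> hemisphere s (edge_path e t) >].

Definition vertex_in (s : bool) (v : vertex N) : bool :=
  `[< hemisphere s (vertex_pos v) >].

Record spherical_network : Prop := SphericalNetwork {
  (* bipartite, with the distinguished vertices distinct and black *)
  black_endP : forall e : edge N, black (black_end e);
  white_endP : forall e : edge N, ~~ black (white_end e);
  equatorial_inj : injective (@equatorial _ _ _ N);
  equatorial_black : forall i : 'I_n, black (equatorial N i);
  (* embedded in the sphere *)
  vertex_pos_sphere : forall v : vertex N, sphere2 (vertex_pos v);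
  vertex_pos_inj : injective (@vertex_pos _ _ _ N);
  edge_path_sphere : forall (e : edge N) (t : R),
    0 <= t <= 1 -> sphere2 (edge_path e t);
  edge_path_continuous : forall e : edge N,
    {within `[0, 1], continuous (edge_path e : R -> R * R * R)}%classic;
  edge_path0 : forall e : edge N, edge_path e 0 = vertex_pos (black_end e);
  edge_path1 : forall e : edge N, edge_path e 1 = vertex_pos (white_end e);
  edge_path_disjoint : forall (e e' : edge N) (t t' : R),
    0 < t < 1 -> 0 <= t' <= 1 ->
    edge_path e t = edge_path e' t' -> e = e' /\ t = t';
  edge_path_vertex : forall (e : edge N) (v : vertex N) (t : R),
    0 < t < 1 -> edge_path e t <> vertex_pos v;
  (* meeting the equator exactly in the distinguished vertices, which are
     placed in cyclic order (in either of the two directions) *)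
  drawn_set_equator :
    (drawn_set `&` @equator R =
      range (fun i : 'I_n => vertex_pos (equatorial N i)))%classic;
  equatorial_ordered : exists (clockwise : bool) (theta : 'I_n -> R),
    (forall i j : 'I_n, (i < j)%N -> theta i < theta j < theta i + 2 * pi) /\
    (forall i : 'I_n, vertex_pos (equatorial N i) =
      (cos (theta i), (-1) ^+ clockwise * sin (theta i), 0));
  (* the distinguished vertices have degree one in each hemisphere; being
     black, they are only joined to interior vertices *)
  equatorial_degree : forall (s : bool) (i : 'I_n),
    #|[set e | edge_in s e & incident (equatorial N i) e]%SET| = 1%N
}.

Definition excess : int :=
  #|[set v | interior_vertex v & ~~ black v]%SET|%:Z
  - #|[set v | interior_vertex v & black v]%SET|%:Z.

(** * Almost perfect matchings and measurements *)

Definition degree_in (P : {set edge N}) (v : vertex N) : nat :=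
  #|[set e in P | incident v e]%SET|.

Definition sphere_matching (P : {set edge N}) : bool :=
  [forall v, interior_vertex v ==> (degree_in P v == 1)%N] &&
  [forall i, (degree_in P (equatorial N i) <= 1)%N].

(* the almost perfect matchings of the part of [N] in one hemisphere *)
Definition disk_matching (s : bool) (P : {set edge N}) : bool :=
  [&& [forall e in P, edge_in s e],
      [forall v, interior_vertex v && vertex_in s v
                   ==> (degree_in P v == 1)%N] &
      [forall i, (degree_in P (equatorial N i) <= 1)%N]].

Definition used (P : {set edge N}) : {set 'I_n} :=
  [set i | [exists e in P, incident (equatorial N i) e]]%SET.

Definition used_in (s : bool) (P : {set edge N}) : {set 'I_n} :=
  [set i | [exists e in P, edge_in s e && incident (equatorial N i) e]]%SET.

Definition inversions (A B : {set 'I_n}) : nat :=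
  #|[set ab : 'I_n * 'I_n |
      [&& ab.1 \in A, ab.2 \in B & (ab.2 < ab.1)%N]]%SET|.

Definition matching_weight (P : {set edge N}) : F := \prod_(e in P) weight e.

Definition equatorial_measurement (I : {set 'I_n}) : F :=
  \sum_(P : {set edge N} | sphere_matching P && (used P == I))
    (-1) ^+ inversions (used_in true P) (used_in false P) * matching_weight P.

Definition disk_measurement (s : bool) (I : {set 'I_n}) : F :=
  \sum_(P : {set edge N} | disk_matching s P && (used P == I))
    matching_weight P.

End Network.

(** * The Grassmannian *)

Definition Gr (F : fieldType) (k n : nat) : Type :=
  {X : {vspace 'rV[F]_n} | \dim X == k}.

Section Grassmannian.
Variables (F : fieldType) (n : nat).

(* The maximal minor on the columns [I], taken in increasing order, of the
   matrix whose rows are a basis of [X].  It is meant for [#|I| = k], and only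
   the resulting vector up to a scalar is independent of the basis. *)
Definition plucker (k : nat) (X : Gr F k n) (I : {set 'I_n}) : F :=
  \det (\matrix_(i < #|I|, j < #|I|) (vbasis (val X))`_i ord0 (enum_val j)).

(* The vector [D] of Plücker coordinates, indexed by the [k]-subsets, defines
   the element [X] of Gr(k, n) with [None] adjoined as the zero vector.  In
   the [Some] case [D] is not identically zero, since [plucker X] is not. *)
Definition plucker_point (k : nat) (D : {set 'I_n} -> F)
    (X : option (Gr F k n)) : Prop :=
  match X with
  | Some Y => exists2 c : F, c != 0 &
      forall I : {set 'I_n}, #|I| = k -> D I = c * plucker Y I
  | None => forall I : {set 'I_n}, #|I| = k -> D I = 0
  end.

(* [X + K], or [None] if its dimension is not [k1 + k2] *)
Definition direct_sum (k1 k2 : nat) (X : Gr F k1 n) (K : Gr F k2 n) :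
    option (Gr F (k1 + k2) n) :=
  insub (val X + val K)%VS.

End Grassmannian.

(* Main.v *)
Require Import Defs.
From HB Require Import structures.
From mathcomp Require Import all_boot all_order all_algebra.
From mathcomp Require Import all_classical all_reals all_analysis.
From mathcomp Require Import ring lra.
(* Sets below are finite sets: the finite versions of names such as [set0],
   [subsetP] and [filter] have to come last. *)
From mathcomp Require Import seq fintype finset.
Set Implicit Arguments.
Unset Strict Implicit.
Unset Printing Implicit Defensive.
Import Order.TTheory GRing.Theory Num.Theory.
Import numFieldNormedType.Exports.
Local Open Scope ring_scope.

(** The equator cuts the network into two independent halves, and the Laplace
    expansion of a minor along a block of rows cuts it in the same way, with the
    same signs.

    Geometry.  The height along an edge is continuous, and it cannot vanish in
    the interior of the edge, because the drawing meets the equator in vertices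
    only.  By the intermediate value theorem each edge lies in exactly one closed
    hemisphere ([edge_inN]), and all edges at an interior vertex lie in the open
    hemisphere of that vertex, up to their other ends.

    Combinatorics.  Hence an almost perfect matching of [N] is a pair of almost
    perfect matchings of the two halves using disjoint sets of equatorial vertices
    ([sphere_matching_parts]); weights multiply, and the sign depends only on the
    two used sets.  Summing over the upper used set [J] gives
    [equatorial_measurement_sum]:
      Delta_I(N) = sum over J in I of
                     (-1)^inv(J, I - J) Delta_J(N+) Delta_(I-J)(N-).
    In a matching of one half every edge has one white end, which is interior,
    and one black end, interior or equatorial; so the number of used equatorial
    vertices is the number of white minus the number of interior black vertices of
    that half ([disk_matching_size]).  A point of Gr(k, n) has a nonzero Pluecker
    coordinate, so some matching exists and that difference is k.  This gives the
    formula for the excess, and shows that only the J with k1 elements count.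

    Linear algebra.  The sum is then, up to the two scalars relating measurements
    to Pluecker coordinates, the Laplace expansion ([minor_cat]) of the minor on
    the columns [I] of a basis of X+ stacked on a basis of X-.  If the stacked rows
    are independent they are a basis of the direct sum, and another basis changes
    all maximal minors by one nonzero factor ([minor_basis_change]); if not, all
    these minors vanish ([minor_dependent]). *)

(** * Inversions between sets of columns *)

Section Inversions.
Variable n : nat.
Implicit Types (i : 'I_n) (A B C : {set 'I_n}).

Lemma inversionsUl A B C : [disjoint A & B] ->
  inversions (A :|: B) C = (inversions A C + inversions B C)%N.
Proof.
move=> dAB; rewrite /inversions -cardsUI.
set S := _ :&: _; suff -> : S = set0.
  rewrite cards0 addn0; apply: eq_card => -[a b]; rewrite !inE /=.
  by rewrite -andb_orl.
apply/setP => -[a b]; rewrite !inE /=.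
case: (boolP (a \in A)) => //= aA.
by rewrite (disjointFr dAB aA) andbF.
Qed.

Lemma inversionsUr A B C : [disjoint B & C] ->
  inversions A (B :|: C) = (inversions A B + inversions A C)%N.
Proof.
move=> dBC; rewrite /inversions -cardsUI.
set S := _ :&: _; suff -> : S = set0.
  rewrite cards0 addn0; apply: eq_card => -[a b]; rewrite !inE /=.
  by rewrite -andb_orr -andb_orl.
apply/setP => -[a b]; rewrite !inE /=.
case: (boolP (b \in B)) => [bB|] /=; last by rewrite andbF.
by rewrite (disjointFr dBC bB) !andbF.
Qed.

Lemma inversions1 i A : inversions [set i] A = #|[set b in A | (b < i)%N]|.
Proof.
rewrite /inversions -(card_imset (mem [set b in A | (b < i)%N]) (f := pair i));
  last by move=> a b [].
apply: eq_card => -[a b]; rewrite !inE /=.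
apply/idP/imsetP => [/and3P[/eqP-> bA lt]|[c + [-> ->]]].
  by exists b; rewrite ?inE ?bA.
by rewrite inE eqxx.
Qed.

Lemma inversions0 A : inversions set0 A = 0%N.
Proof. by rewrite /inversions; apply: eq_card0 => -[a b]; rewrite !inE. Qed.

Lemma enum_filter A : enum A = [seq i <- enum 'I_n | i \in A].
Proof. by rewrite enumT. Qed.

Lemma enum_sorted A : sorted (fun i j => (i < j)%N) (enum A).
Proof.
rewrite enum_filter; apply: sorted_filter => [y x z|]; first exact: ltn_trans.
by rewrite -(@sorted_map _ _ val ltn) val_enum_ord iota_ltn_sorted.
Qed.

(** The sign in the expansion of a determinant along its first row is given by the
    position of the column; here that position becomes an inversion count. *)
Lemma inversions_position A i p q : enum A = p ++ i :: q ->
  inversions [set i] (A :\ i) = size p.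
Proof.
move=> eA; have := enum_sorted A; rewrite eA.
have trl : transitive (fun i j : 'I_n => (i < j)%N) by move=> y x z; apply: ltn_trans.
rewrite (sorted_pairwise trl) pairwise_cat /= => /and4P[pq _ iq _].
have uA : uniq (p ++ i :: q) by rewrite -eA enum_uniq.
have up : uniq p by move: uA; rewrite cat_uniq => /and3P[].
rewrite inversions1 -(card_uniqP up).
apply: eq_card => b; rewrite !inE -(mem_enum A) eA mem_cat inE.
have [bp|bp] := boolP (b \in p) => /=.
  have lt : (b < i)%N by move/allrelP: pq; apply; rewrite ?inE ?eqxx.
  by rewrite lt !andbT -val_eqE ltn_eqF.
have [->|/=] := eqVneq b i; first by [].
case: (boolP (b \in q)) => //= bq _.
by rewrite ltnNge ltnW //; move/allP: iq; apply.
Qed.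
End Inversions.

(** * Maximal minors and the Laplace expansion *)

Section Minors.
Variables (F : fieldType) (n : nat).
Implicit Types (s : seq 'rV[F]_n) (I J K : {set 'I_n}).

(** The size [m] is separate from the lists, so that equations such as
    [#|I| = m.+1] can be rewritten without casts.  Columns are read off through
    [map] because ['I_n] may be empty and has no default element. *)
Definition minor_mx (m : nat) s (t : seq 'I_n) : 'M[F]_m :=
  \matrix_(i < m, j < m) [seq s`_i ord0 a | a <- t]`_j.

Definition minor s I : F := \det (minor_mx #|I| s (enum I)).

Lemma plucker_minor k (X : Gr F k n) I : plucker X I = minor (vbasis (val X)) I.
Proof.
congr (\det _); apply/matrixP => i j; rewrite !mxE.
have i0 : 'I_n := enum_val j.
by rewrite (nth_map i0) -?cardE // (enum_val_nth i0).
Qed.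

Lemma minor_cons x s I : (0 < #|I|)%N ->
  minor (x :: s) I =
  \sum_(i in I) (-1) ^+ inversions [set i] (I :\ i) * x ord0 i * minor s (I :\ i).
Proof.
move=> I_gt0; rewrite /minor.
have [m cI] : exists m, #|I| = m.+1 by exists #|I|.-1; rewrite prednK.
have sz : size (enum I) = m.+1 by rewrite -cardE.
rewrite cI (expand_det_row _ ord0) -[RHS]big_enum /=.
have [i0 _] := card_gt0P I_gt0.
rewrite [RHS](big_nth i0) sz big_mkord; apply: eq_bigr => j _.
have ltj : (j < size (enum I))%N by rewrite sz.
set i := nth i0 _ j; have iI : i \in I by rewrite -mem_enum mem_nth.
have eI : enum I = take j (enum I) ++ i :: drop j.+1 (enum I).
  by rewrite -drop_nth // cat_take_drop.
have sp : size (take j (enum I)) = j by rewrite size_takel // ltnW.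
have eIi : enum (I :\ i) = take j (enum I) ++ drop j.+1 (enum I).
  have -> : enum (I :\ i) = filter (predC1 i) (enum I).
    rewrite (enum_filter (I :\ i)) (enum_filter I) -[RHS]filter_predI.
    by apply: eq_filter => a; rewrite !inE.
  have uI : uniq (take j (enum I) ++ i :: drop j.+1 (enum I)).
    by rewrite -eI enum_uniq.
  rewrite {1}eI -rem_filter //.
  have := uI; rewrite cat_uniq /= negb_or => /and3P[_ /andP[ni _] _].
  elim: (take _ _) ni => /= [|a p IH]; rewrite ?eqxx // inE negb_or eq_sym.
  by case/andP=> /negPf-> /IH->.
rewrite (inversions_position eI) sp !mxE (nth_map i0) //= mulrAC [RHS]mulrC.
congr (_ * _); rewrite /cofactor add0n; congr (_ * _).
have cIi : #|I :\ i| = m by apply/eqP; rewrite -eqSS -cI (cardsD1 i I) iI.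
rewrite cIi; congr (\det _); apply/matrixP => a b; rewrite !mxE /=.
have lb : (b < size (enum (I :\ i)))%N.
  by rewrite -cardE cIi.
have lbI : (lift j b < size (enum I))%N by rewrite sz.
rewrite (nth_map i0 0 _ lbI) (nth_map i0 0 _ lb) /=; congr ((s`_a) ord0 _).
rewrite eI eIi !nth_cat sp /bump; case: (leqP j b) => jb.
  rewrite add1n ltnNge (leqW jb) /= subSn //= ltnNge jb /=.
by rewrite add0n jb.
Qed.

Lemma minor_nil I : #|I| = 0%N -> minor [::] I = 1.
Proof. by rewrite /minor => ->; apply: det_mx00. Qed.

(** Laplace expansion along the first block of rows, by induction on that block.
    Expanding along the first row and then the rest, or splitting off the block and
    then expanding it, yields the same sum over [i \in K], [K \subset I].  The signs
    agree because, for [K = i |: J] and [C] the complement of [K] in [I], both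
    total inversion counts are inv(i, J) + inv(i, C) + inv(J, C). *)
Lemma minor_cat s1 s2 I : #|I| = (size s1 + size s2)%N ->
  minor (s1 ++ s2) I =
  \sum_(J : {set 'I_n} | (J \subset I) && (#|J| == size s1))
     (-1) ^+ inversions J (I :\: J) * minor s1 J * minor s2 (I :\: J).
Proof.
elim: s1 I => [|x s1 IH] I cI /=.
  rewrite (big_pred1 set0) => [|J]; last first.
    by rewrite /= cards_eq0; case: eqP => [->|]; rewrite ?sub0set ?andbF.
  by rewrite inversions0 setD0 minor_nil ?cards0 // !mul1r.
have I_gt0 : (0 < #|I|)%N by rewrite cI.
rewrite minor_cons //.
(* [i] is the column of the first row, [K] the columns of the first block. *)
pose G i K := (-1) ^+ inversions K (I :\: K) *
  ((-1) ^+ inversions [set i] (K :\ i) * x ord0 i * minor s1 (K :\ i)) *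
  minor s2 (I :\: K).
transitivity (\sum_(K : {set 'I_n} | (K \subset I) && (#|K| == (size s1).+1))
    \sum_(i in K) G i K); last first.
  apply: eq_bigr => K /andP[_ /eqP cK].
  by rewrite minor_cons ?cK // mulr_sumr mulr_suml.
rewrite (exchange_big_dep (mem I)) /=; last first.
  by move=> K i /andP[/subsetP KI _]; apply: KI.
apply: eq_bigr => i iI.
have cIi : #|I :\ i| = (size s1 + size s2)%N.
  by apply/eqP; rewrite -eqSS -[(#|_|).+1]add1n -{1}[1%N]/(true : nat) -iI -cardsD1 cI.
rewrite IH // mulr_sumr.
rewrite [RHS](reindex_onto (fun J => i |: J) (fun K => K :\ i)) /=; last first.
  by move=> K /andP[_ iK]; rewrite setD1K.
apply: eq_big => [J|J /andP[JI cJ]].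
  rewrite setU11 andbT subUset sub1set iI /= subsetD1 cardsU1.
  have [iJ|iJ] := boolP (i \in J).
    rewrite andbF /=; apply/esym/negbTE; rewrite negb_and orbC; apply/orP; left.
    by apply: contraL iJ => /eqP<-; rewrite !inE eqxx.
  by rewrite setU1K // eqxx !andbT add1n eqSS.
have iJ : i \notin J by move: JI; rewrite subsetD1 => /andP[].
have JsI : J \subset I by move: JI; rewrite subsetD1 => /andP[].
rewrite /G setU1K //.
have -> : I :\: (i |: J) = (I :\ i) :\: J by rewrite setDDl.
set C := (I :\ i) :\: J.
have eIi : I :\ i = J :|: C.
  by apply/setP => a; rewrite !inE; case: (boolP (a \in J)) => //= aJ;
     move/subsetP: JI => /(_ a aJ); rewrite !inE.
have dJC : [disjoint J & C].
  by rewrite -setI_eq0; apply/eqP/setP => a; rewrite !inE; case: (a \in J).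
rewrite eIi inversionsUr // inversionsUl; last by rewrite disjoints1.
rewrite !exprD; ring.
Qed.

(** The factor is the determinant of the change of basis; it is nonzero because the
    change in the other direction is its inverse. *)
Lemma minor_basis_change m (U : {vspace 'rV[F]_n}) (X Y : m.-tuple 'rV[F]_n) :
  basis_of U X -> basis_of U Y ->
  exists2 c : F, c != 0 & forall I, #|I| = m -> minor X I = c * minor Y I.
Proof.
move=> bX bY.
pose G (X Y : m.-tuple 'rV[F]_n) : 'M[F]_m := \matrix_(i, j) coord Y j X`_i.
have GP (X' Y' : m.-tuple 'rV[F]_n) : basis_of U X' -> basis_of U Y' ->
    forall i : 'I_m, X'`_i = \sum_j G X' Y' i j *: Y'`_j.
  move=> bX' bY' i; rewrite [LHS](coord_basis bY').
    by apply: eq_bigr => j _; rewrite mxE.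
  by apply: (basis_mem bX'); rewrite mem_nth ?size_tuple.
have GG : G X Y *m G Y X = 1%:M.
  apply/matrixP => i k; rewrite !mxE -(coord_free i k (basis_free bX)).
  rewrite [X in _ = coord _ _ X](GP _ _ bX bY i) linear_sum; apply: eq_bigr => j _ /=.
  by rewrite linearZ !mxE.
exists (\det (G X Y)).
  by case: (mulmx1_unit GG); rewrite unitmxE unitfE.
move=> I cI; rewrite /minor cI -det_mulmx; congr (\det _).
apply/matrixP => i k; rewrite !mxE.
have ltk : (k < size (enum I))%N by rewrite -cardE cI.
have i0 : 'I_n by case: (enum I) ltk => // a.
rewrite (nth_map i0) // (GP _ _ bX bY i) summxE; apply: eq_bigr => j _.
by rewrite !mxE (nth_map i0).
Qed.

(** A linear relation among the rows is a row vector annihilated by the square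
    matrix; an invertible matrix annihilates only the zero vector. *)
Lemma minor_dependent m (X : m.-tuple 'rV[F]_n) I :
  ~~ free X -> #|I| = m -> minor X I = 0.
Proof.
move=> + cI; apply: contraNeq; rewrite /minor cI => dn0.
apply/freeP => k k0.
have uM : minor_mx m X (enum I) \in unitmx by rewrite unitmxE unitfE.
pose v := \row_i k i.
suff v0 : v = 0.
  by move=> i; have := congr1 (fun w : 'rV_m => w ord0 i) v0; rewrite !mxE.
rewrite -[v](mulmxK uM) (_ : v *m _ = 0) ?mul0mx //.
apply/rowP => j; rewrite !mxE.
have ltj : (j < size (enum I))%N by rewrite -cardE cI.
have i0 : 'I_n by case: (enum I) ltj => // a.
have := congr1 (fun w : 'rV_n => w ord0 (nth i0 (enum I) j)) k0.
rewrite summxE mxE => {2}<-; apply: eq_bigr => i _.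
by rewrite !mxE (nth_map i0).
Qed.

(** A matrix of full row rank has an invertible square submatrix, but its columns
    come as an injection [f] with no order.  Listing the image of [f] increasingly
    only permutes these columns, which does not affect the rank. *)
Lemma exists_minor_neq0 m (X : m.-tuple 'rV[F]_n) :
  free X -> exists2 I : {set 'I_n}, #|I| = m & minor X I != 0.
Proof.
move=> fX; pose M : 'M[F]_(m, n) := \matrix_(i, a) X`_i ord0 a.
have freeM : row_free M.
  apply: inj_row_free => v v0; apply/rowP => i; rewrite [RHS]mxE.
  apply: (freeP fX) i; apply/rowP => a.
  have := congr1 (fun w : 'rV_n => w ord0 a) v0.
  rewrite !mxE summxE => {2}<-; apply: eq_bigr => i _.
  by rewrite !mxE.
have fullM : row_full M^T by rewrite /row_full mxrank_tr.
pose f := fullrankfun fullM; pose I : {set 'I_n} := f @: 'I_m.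
have cI : #|I| = m by rewrite card_imset ?card_ord //; apply: fullrankfun_inj.
have idx i : (index (f i) (enum I) < m)%N.
  by rewrite -[X in (_ < X)%N]cI cardE index_mem mem_enum imset_f.
pose h i := Ordinal (idx i).
pose g (j : 'I_m) := nth (f j) (enum I) j.
have fgh : f =1 g \o h.
  by move=> i; rewrite /= /g /h /= nth_index // mem_enum imset_f.
exists I => //.
suff : row_full (rowsub g M^T).
  have -> : minor X I = \det (rowsub g M^T).
    rewrite /minor cI -det_tr; congr (\det _); apply/matrixP => j i; rewrite !mxE.
    by rewrite (nth_map (f j)) // -cardE cI.
  by rewrite row_full_unit unitmxE unitfE.
have := fullrowsub_full fullM; rewrite -!sub1mx => /submx_trans; apply.
exact: submx_rowsub fgh.
Qed.

End Minors.

(** * The two hemispheres *)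

Section Hemispheres.
Variables (R : realType) (F : fieldType) (n : nat) (N : network R F n).
Hypothesis hN : spherical_network N.
Implicit Types (s : bool) (e : edge N) (v : vertex N) (P : {set edge N}) (i : 'I_n).

Lemma vertex_off_equator v : interior_vertex v -> (vertex_pos v).2 != 0.
Proof.
move=> iv; apply/eqP => v0.
have : (drawn_set N `&` @equator R)%classic (vertex_pos v).
  by split; [left; exists v|split => //; exact: vertex_pos_sphere].
rewrite (drawn_set_equator hN) => -[i _ /(vertex_pos_inj hN) iE].
by move: iv; rewrite /interior_vertex -iE codom_f.
Qed.

Lemma edge_off_equator e (t : R) : 0 < t < 1 -> (edge_path e t).2 != 0.
Proof.
move=> t01; have t01' : 0 <= t <= 1 by case/andP: t01 => /ltW-> /ltW->.
apply/eqP => e0.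
have : (drawn_set N `&` @equator R)%classic (edge_path e t).
  by split; [right; exists e, t|split => //; exact: edge_path_sphere].
rewrite (drawn_set_equator hN) => -[i _ /esym].
exact: edge_path_vertex.
Qed.

Lemma edge_inP s e :
  reflect (forall t : R, 0 <= t <= 1 -> if s then 0 <= (edge_path e t).2
                                         else (edge_path e t).2 <= 0)
          (edge_in s e).
Proof.
apply: (iffP (asboolP _)) => h t t01; first by case: (h t t01).
by split; [exact: edge_path_sphere | exact: h].
Qed.

Lemma vertex_inE s v :
  vertex_in s v = if s then 0 <= (vertex_pos v).2 else (vertex_pos v).2 <= 0.
Proof.
apply/asboolP/idP => [[_]|h]; first by [].
by split; first exact: vertex_pos_sphere.
Qed.

Lemma height_continuous e :
  {within `[0, 1], continuous (fun t : R => (edge_path e t).2)}%classic.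
Proof.
move=> t; apply: (@continuous_comp _ _ _ (edge_path e : subspace `[0, 1]%classic -> _) snd).
  exact: edge_path_continuous.
exact: cvg_snd.
Qed.

(** By the intermediate value theorem the edge would cross the equator between the
    parameters [t] and [u], hence at an interior point of the edge even when [t] or
    [u] is an endpoint. *)
Lemma height_no_crossing e (t u : R) : 0 <= t <= 1 -> 0 <= u <= 1 ->
  (edge_path e t).2 < 0 -> 0 < (edge_path e u).2 -> False.
Proof.
move=> t01 u01 ft fu.
pose f (t : R) := (edge_path e t).2.
have mm : Num.min t u <= Num.max t u by rewrite ge_min le_max lexx.
have sub : (`[Num.min t u, Num.max t u] `<=` `[0, 1])%classic.
  move=> c /=; rewrite !in_itv /= => /andP[a b].
  case/andP: t01 => t0 t1; case/andP: u01 => u0 u1.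
  by apply/andP; split; [apply: le_trans a|apply: (le_trans b)];
     rewrite ?le_min ?ge_max ?t0 ?u0 ?t1 ?u1.
have := @IVT R f _ _ 0 mm (continuous_subspaceW sub (@height_continuous e)).
have -> : Num.min (f (Num.min t u)) (f (Num.max t u)) <= 0 <=
          Num.max (f (Num.min t u)) (f (Num.max t u)).
  rewrite ge_min le_max.
  by case: (leP t u) => _; rewrite (ltW ft) (ltW fu) /= ?orbT.
case=> // c cI fc.
have tc : t != c by apply: contraTneq ft => ->; rewrite -/(f c) fc ltxx.
have uc : u != c by apply: contraTneq fu => ->; rewrite -/(f c) fc ltxx.
suff /(edge_off_equator e) : 0 < c < 1 by rewrite -/(f c) fc eqxx.
move: cI; rewrite in_itv /= ge_min le_max.
rewrite !le_eqVlt (negPf tc) (negPf uc) ![c == _]eq_sym (negPf tc) (negPf uc) /=.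
move: t01 u01 => /andP[t0 t1] /andP[u0 u1] /andP[/orP a /orP b].
apply/andP; split.
  by case: a => [/(le_lt_trans t0)|/(le_lt_trans u0)].
by case: b => [/lt_le_trans/(_ t1)|/lt_le_trans/(_ u1)].
Qed.

(** Every edge lies in exactly one closed hemisphere: not in none, as it would cross
    the equator, and not in both, as its midpoint would lie on the equator. *)
Lemma edge_inN s e : edge_in (~~ s) e = ~~ edge_in s e.
Proof.
suff down_up : edge_in false e = ~~ edge_in true e.
  by case: s; rewrite /= down_up // negbK.
apply/idP/idP => [/edge_inP/= down|/edge_inP up].
  apply/negP => /edge_inP/= up.
  have h01 : 0 < (2^-1 : R) < 1 by lra.
  have h01' : 0 <= (2^-1 : R) <= 1 by lra.
  by have := edge_off_equator e h01; rewrite eq_le up ?down.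
apply/edge_inP => t t01 /=; rewrite leNgt; apply/negP => ft.
apply: up => u u01 /=; rewrite leNgt; apply/negP => fu.
exact: (height_no_crossing u01 t01 fu ft).
Qed.

Lemma vertex_inN s v : interior_vertex v -> vertex_in (~~ s) v = ~~ vertex_in s v.
Proof.
move/vertex_off_equator => v0; rewrite !vertex_inE.
by case: s => /=; rewrite -ltNge lt_neqAle ?v0 // eq_sym v0.
Qed.

Lemma edge_in_vertex_in s e v : edge_in s e -> incident v e -> vertex_in s v.
Proof.
move=> /edge_inP es; rewrite /incident vertex_inE => /orP[]/eqP<-.
  by rewrite -(edge_path0 hN); apply: es; rewrite lexx ler01.
by rewrite -(edge_path1 hN); apply: es; rewrite lexx ler01.
Qed.

Lemma interior_incident_edge_in s e v : interior_vertex v -> vertex_in s v ->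
  incident v e -> edge_in s e.
Proof.
move=> iv vs ve; rewrite -[s]negbK edge_inN; apply/negP => es.
by have := edge_in_vertex_in es ve; rewrite vertex_inN // vs.
Qed.

Lemma white_interior v : ~~ black v -> interior_vertex v.
Proof.
by apply: contraNN => /codomP[i ->]; apply: equatorial_black.
Qed.

Definition white_vertices s : {set vertex N} :=
  [set v | [&& interior_vertex v, vertex_in s v & ~~ black v]].
Definition black_vertices s : {set vertex N} :=
  [set v | [&& interior_vertex v, vertex_in s v & black v]].

Lemma excess_hemispheres :
  excess N = (#|white_vertices true|%:Z - #|black_vertices true|%:Z)
           + (#|white_vertices false|%:Z - #|black_vertices false|%:Z).
Proof.
have split_card (B : pred (vertex N)) :
    (#|[set v | interior_vertex v & B v]| =
     #|[set v | [&& interior_vertex v, vertex_in true v & B v]]| +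
     #|[set v | [&& interior_vertex v, vertex_in false v & B v]]|)%N.
  rewrite -(cardsID [set v | vertex_in true v]); congr addn; apply: eq_card => v;
    rewrite !inE.
    by case: interior_vertex => //=; rewrite andbC.
  have [/(vertex_inN true)/= ->|_] := boolP (interior_vertex v); last by rewrite !andbF.
  by [].
have -> : excess N = (#|white_vertices true| + #|white_vertices false|)%N%:Z -
                     (#|black_vertices true| + #|black_vertices false|)%N%:Z.
  by congr (_%:Z - _%:Z); apply: split_card.
by rewrite !PoszD opprD addrACA.
Qed.

(** * Matchings of one hemisphere *)

Lemma degree_in_gt0P P v :
  reflect (exists2 e, e \in P & incident v e) (0 < degree_in P v)%N.
Proof.
apply: (iffP card_gt0P) => [[e]|[e eP ve]]; first by rewrite !inE => /andP[]; exists e.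
by exists e; rewrite !inE eP.
Qed.

Lemma usedE P i : (i \in used P) = (0 < degree_in P (equatorial N i))%N.
Proof.
rewrite inE; apply/exists_inP/degree_in_gt0P => -[e eP ie]; by exists e.
Qed.

Lemma matched_edge_inj P e e' v : (degree_in P v <= 1)%N ->
  e \in P -> e' \in P -> incident v e -> incident v e' -> e = e'.
Proof.
by move=> /card_le1_eqP P1 eP e'P ve ve'; apply: P1; rewrite !inE ?eP ?e'P.
Qed.

Lemma disk_matching_degree s P v : disk_matching s P -> (degree_in P v <= 1)%N.
Proof.
case/and3P=> /forall_inP Ps /forallP Pint /forallP Peq.
have [/codomP[i ->]|iv] := boolP (v \in codom (@equatorial _ _ _ N)); first exact: Peq.
have [->//|] := eqVneq (degree_in P v) 0%N.
rewrite -lt0n => /degree_in_gt0P[e eP ve].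
have /implyP := Pint v.
by rewrite (edge_in_vertex_in (Ps e eP) ve) andbT => /(_ iv) /eqP->.
Qed.

(** The edges of a matching are counted twice: sending an edge to its white end, or
    to its black end, is injective.  The white ends are all the white vertices of
    the hemisphere, and the black ends are its interior black vertices together
    with the used equatorial ones. *)
Lemma disk_matching_size s P : disk_matching s P ->
  #|white_vertices s| = (#|black_vertices s| + #|used P|)%N.
Proof.
move=> dP; have deg v := disk_matching_degree v dP.
case/and3P: dP => /forall_inP Ps /forallP Pint _.
have cover v : interior_vertex v -> vertex_in s v -> exists2 e, e \in P & incident v e.
  move=> iv vs; apply/degree_in_gt0P.
  by have /implyP := Pint v; rewrite iv vs => /(_ isT)/eqP->.
have bE e : incident (black_end e) e by rewrite /incident eqxx.
have wE e : incident (white_end e) e by rewrite /incident eqxx orbT.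
have <- : #|[set white_end e | e in P]| = #|white_vertices s|.
  apply: eq_card => v; rewrite inE; apply/imsetP/and3P => [[e eP ->]|[iv vs wv]].
    have wv := white_endP hN e.
    by split; [exact: white_interior|exact: edge_in_vertex_in (Ps e eP) _|].
  have [e eP /orP[/eqP ev|/eqP ev]] := cover v iv vs; last by exists e.
  by move: wv; rewrite -ev black_endP.
have -> : (#|black_vertices s| + #|used P|)%N = #|[set black_end e | e in P]|.
  rewrite -(card_imset (mem (used P)) (equatorial_inj hN)) -cardsUI.
  set S := _ :&: _; have -> : S = set0.
    apply/setP => v; rewrite !inE; apply/negbTE/negP => /andP[/and3P[iv _ _]].
    by case/imsetP => i _ vi; move: iv; rewrite /interior_vertex vi codom_f.
  rewrite cards0 addn0; apply: eq_card => v; rewrite !inE.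
  apply/orP/imsetP => [[/and3P[iv vs bv]|/imsetP[i + ->]]|[e eP ->]].
  - have [e eP /orP[/eqP ev|/eqP ev]] := cover v iv vs; first by exists e.
    by move: bv; rewrite -ev (negPf (white_endP hN e)).
  - rewrite usedE => /degree_in_gt0P[e eP /orP[/eqP ev|/eqP ev]]; first by exists e.
    by have := equatorial_black hN i; rewrite -ev (negPf (white_endP hN e)).
  - have [/codomP[i ei]|iv] := boolP (black_end e \in codom (@equatorial _ _ _ N)).
      right; rewrite ei; apply: imset_f; rewrite usedE; apply/degree_in_gt0P.
      by exists e => //; rewrite -ei.
    by left; rewrite /interior_vertex iv black_endP // (edge_in_vertex_in (Ps e eP)).
rewrite !card_in_imset // => e e' eP e'P ee'.
  by apply: (@matched_edge_inj P _ _ (black_end e)) => //; rewrite ee'.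
by apply: (@matched_edge_inj P _ _ (white_end e)) => //; rewrite ee'.
Qed.

(** * Cutting a matching along the equator *)

Definition hemisphere_part s P : {set edge N} := [set e in P | edge_in s e].

Lemma hemisphere_partU P : hemisphere_part true P :|: hemisphere_part false P = P.
Proof.
by apply/setP => e; rewrite !inE (edge_inN true) -andb_orr orbN andbT.
Qed.

Lemma hemisphere_part_union s P1 P2 :
  [forall e in P1, edge_in s e] -> [forall e in P2, edge_in (~~ s) e] ->
  hemisphere_part s (P1 :|: P2) = P1.
Proof.
move=> /forall_inP h1 /forall_inP h2; apply/setP => e; rewrite !inE.
have [/h1->//|_ /=] := boolP (e \in P1).
by have [/h2|//] := boolP (e \in P2); rewrite edge_inN /= => /negPf.
Qed.

Lemma degree_in_parts P v : degree_in P v =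
  (degree_in (hemisphere_part true P) v + degree_in (hemisphere_part false P) v)%N.
Proof.
rewrite /degree_in -(cardsID [set e | edge_in true e]); congr addn;
  apply: eq_card => e; rewrite !inE ?(edge_inN true); first by rewrite andbAC.
by rewrite andbC andbAC.
Qed.

Lemma degree_in_other_part s P v : interior_vertex v -> vertex_in s v ->
  degree_in (hemisphere_part (~~ s) P) v = 0%N.
Proof.
move=> iv vs; apply/eqP; rewrite -leqn0 leqNgt; apply/degree_in_gt0P => -[e].
rewrite inE edge_inN => /andP[_ nes] ve.
by rewrite (interior_incident_edge_in iv vs ve) in nes.
Qed.

Lemma degree_in_part s P v : interior_vertex v -> vertex_in s v ->
  degree_in P v = degree_in (hemisphere_part s P) v.
Proof.
move=> iv vs; rewrite degree_in_parts.
by have := degree_in_other_part P iv vs; case: s vs => vs /= ->; rewrite ?addn0.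
Qed.

Lemma used_parts P :
  used P = used (hemisphere_part true P) :|: used (hemisphere_part false P).
Proof. by apply/setP => i; rewrite in_setU !usedE degree_in_parts addn_gt0. Qed.

Lemma used_in_part s P : used_in s P = used (hemisphere_part s P).
Proof.
apply/setP => i; rewrite !inE; apply: eq_existsb => e.
by rewrite !inE andbA.
Qed.

Lemma matching_weight_parts P : matching_weight P =
  matching_weight (hemisphere_part true P) * matching_weight (hemisphere_part false P).
Proof.
rewrite /matching_weight (bigID (edge_in true)) /=; congr (_ * _); apply: eq_bigl => e;
  by rewrite !inE ?(edge_inN true).
Qed.

(** An interior vertex only meets edges of its own hemisphere, so the condition there
    concerns one part.  An equatorial vertex has the sum of its degrees in the two
    parts as its degree; this is at most one exactly when neither exceeds one and
    the vertex is not used on both sides. *)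
Lemma sphere_matching_parts P : sphere_matching P =
  [&& disk_matching true (hemisphere_part true P),
      disk_matching false (hemisphere_part false P) &
      [disjoint used (hemisphere_part true P) & used (hemisphere_part false P)]].
Proof.
have inpart s : [forall e in hemisphere_part s P, edge_in s e].
  by apply/forall_inP => e; rewrite inE => /andP[].
rewrite /disk_matching !inpart /= -setI_eq0.
apply/andP/and3P => [[/forallP Pint /forallP Peq]|].
  have deg s v : interior_vertex v && vertex_in s v ==>
      (degree_in (hemisphere_part s P) v == 1)%N.
    apply/implyP => /andP[iv vs]; rewrite -(degree_in_part P iv vs).
    exact: implyP (Pint v) iv.
  split.
  - apply/andP; split; apply/forallP => // i; apply: leq_trans (Peq i).
    by rewrite [X in (_ <= X)%N]degree_in_parts leq_addr.
  - apply/andP; split; apply/forallP => // i; apply: leq_trans (Peq i).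
    by rewrite [X in (_ <= X)%N]degree_in_parts leq_addl.
  apply/eqP/setP => i; rewrite in_set0 in_setI !usedE; apply/negbTE/negP => /andP[a b].
  have := Peq i; rewrite degree_in_parts leqNgt => /negP; apply.
  exact: leq_add a b.
case=> /andP[/forallP it /forallP et] /andP[/forallP jf /forallP ef] /eqP dis.
split; apply/forallP; [move=> v|move=> i].
  apply/implyP => iv; have [vt|] := boolP (vertex_in true v).
    by rewrite (degree_in_part P iv vt); have /implyP := it v; rewrite iv vt; apply.
  rewrite -(vertex_inN _ iv) => vf.
  by rewrite (degree_in_part P iv vf); have /implyP := jf v; rewrite iv vf; apply.
have : i \notin used (hemisphere_part true P) :&: used (hemisphere_part false P).
  by rewrite dis inE.
rewrite in_setI !usedE (degree_in_parts P) negb_and -!leqNgt !leqn0.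
by case/orP => /eqP->; rewrite ?add0n ?addn0 ?et ?ef.
Qed.

(** The matchings using [I] are grouped by the set [J] used in the upper part, and
    within each group they correspond to pairs of matchings of the two parts. *)
Lemma equatorial_measurement_sum (I : {set 'I_n}) :
  equatorial_measurement N I =
  \sum_(J : {set 'I_n} | J \subset I) (-1) ^+ inversions J (I :\: J) *
     disk_measurement N true J * disk_measurement N false (I :\: J).
Proof.
rewrite /equatorial_measurement.
rewrite (partition_big (fun P => used (hemisphere_part true P))
                       (fun J : {set 'I_n} => J \subset I)) /=; last first.
  by move=> P /andP[_ /eqP<-]; rewrite [used P]used_parts subsetUl.
apply: eq_bigr => J JI; rewrite -mulrA [X in _ * X]big_distrlr pair_big /= mulr_sumr.
pose h P := (hemisphere_part true P, hemisphere_part false P).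
rewrite [RHS](reindex_onto h (fun p => p.1 :|: p.2)) /=; last first.
  move=> [P1 P2] /= /andP[/andP[/and3P[h1 _ _] _] /andP[/and3P[h2 _ _] _]].
  by congr pair; [|rewrite setUC]; exact: hemisphere_part_union.
have usedD P :
    [disjoint used (hemisphere_part true P) & used (hemisphere_part false P)] ->
    used P :\: used (hemisphere_part true P) = used (hemisphere_part false P).
  move=> dis; rewrite [used P]used_parts setDUl setDv set0U; apply/setDidPl.
  by rewrite disjoint_sym.
apply: eq_big => [P|P /andP[/andP[sP /eqP uI] /eqP uJ]].
  rewrite hemisphere_partU eqxx andbT sphere_matching_parts.
  have [uJ|_] := eqVneq (used (hemisphere_part true P)) J; last by rewrite !andbF.
  rewrite !andbT /=.
  case: (disk_matching true _) => //=; case: (disk_matching false _) => //=.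
  apply/andP/eqP => [[/usedD dis /eqP<-]|uF].
    by rewrite -dis uJ.
  rewrite [used P]used_parts uJ uF.
  split; first by rewrite -setI_eq0 setIDA setIC setDE -setIA setICr setI0.
  by apply/eqP; rewrite -[X in X :|: _](setIidPr JI) setID.
move: sP; rewrite sphere_matching_parts => /and3P[_ _ dis].
by rewrite !used_in_part uJ -(usedD P dis) uI uJ matching_weight_parts.
Qed.

(** A point of the Grassmannian has a nonzero Pluecker coordinate, so the disk has
    a matching using exactly [k] boundary vertices. *)
Lemma disk_measurement_excess s k (X : Gr F k n) :
  plucker_point (disk_measurement N s) (Some X) ->
  #|white_vertices s| = (#|black_vertices s| + k)%N.
Proof.
case=> c c0 DX; have /eqP dX := valP X.
have [I cI mI] := exists_minor_neq0 (basis_free (vbasisP (val X))).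
rewrite dX in cI; have : disk_measurement N s I != 0.
  by rewrite DX // mulf_neq0 // plucker_minor.
rewrite /disk_measurement.
have [P /andP[dP /eqP uP] _|none] := pickP (fun P => disk_matching s P && (used P == I)).
  by rewrite -cI -uP; apply: disk_matching_size.
by rewrite big_pred0 ?eqxx.
Qed.

Lemma disk_measurement_eq0 s k (J : {set 'I_n}) :
  #|white_vertices s| = (#|black_vertices s| + k)%N -> #|J| != k ->
  disk_measurement N s J = 0.
Proof.
move=> ex Jk; apply: big1 => P /andP[dP /eqP uP].
by move: Jk; rewrite -uP -(eqn_add2l #|black_vertices s|) -ex (disk_matching_size dP) eqxx.
Qed.

(** * Stacking bases of the two points *)

(** Only the sets [J] of size [k1] contribute to the sum over [J], and these are the
    terms of the Laplace expansion of the stacked bases. *)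
Lemma equatorial_measurement_minor k1 k2 (Xp : Gr F k1 n) (Xm : Gr F k2 n) :
  plucker_point (disk_measurement N true) (Some Xp) ->
  plucker_point (disk_measurement N false) (Some Xm) ->
  exists2 c : F, c != 0 & forall I : {set 'I_n}, #|I| = (k1 + k2)%N ->
    equatorial_measurement N I = c * minor (vbasis (val Xp) ++ vbasis (val Xm)) I.
Proof.
move=> hXp hXm; have exp := disk_measurement_excess hXp.
case: hXp hXm => cp cp0 Dp [cm cm0 Dm].
have /eqP dp := valP Xp; have /eqP dm := valP Xm.
exists (cp * cm) => [|I cI]; first exact: mulf_neq0.
rewrite minor_cat ?size_tuple ?dp ?dm // equatorial_measurement_sum mulr_sumr.
rewrite (bigID (fun J : {set 'I_n} => #|J| == k1)) /= [X in _ + X]big1 ?addr0.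
  apply: eq_big => [J|J /andP[JI /eqP cJ]]; first by congr (_ && (_ == _)); exact/esym.
  rewrite Dp // Dm ?plucker_minor; last first.
    by rewrite cardsD (setIidPr JI) cI cJ addKn.
  ring.
move=> J /andP[_ cJ]; by rewrite (disk_measurement_eq0 exp cJ) mulr0 mul0r.
Qed.
End Hemispheres.

(** * The direct sum *)

Theorem theorem19p10 (R : realType) (F : fieldType) (n : nat)
    (N : network R F n) (hN : spherical_network N)
    (k1 k2 : nat) (Xp : Gr F k1 n) (Xm : Gr F k2 n)
    (hXp : plucker_point (disk_measurement N true) (Some Xp))
    (hXm : plucker_point (disk_measurement N false) (Some Xm)) :
  excess N = (k1 + k2)%:Z /\
  plucker_point (equatorial_measurement N) (direct_sum Xp Xm).
Proof.
split.
  rewrite excess_hemispheres // (disk_measurement_excess hN hXp).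
  by rewrite (disk_measurement_excess hN hXm) !PoszD !(addrC (Posz #|_|)) !addrK.
have [c c0 Dc] := equatorial_measurement_minor hN hXp hXm.
set B := vbasis (val Xp) ++ vbasis (val Xm) in Dc.
have /eqP dp := valP Xp; have /eqP dm := valP Xm.
have szB : size B == (k1 + k2)%N by rewrite size_cat !size_tuple dp dm.
have spanB : <<B>>%VS = (val Xp + val Xm)%VS.
  by rewrite span_cat !(span_basis (vbasisP _)).
rewrite /direct_sum; case: insubP => [Y dY YE|dY] /=.
  have dY' : \dim (val Y) = (k1 + k2)%N by apply/eqP; exact: (valP Y).
  have basisB : basis_of (val Y) (Tuple szB).
    by rewrite basisEdim /= spanB -YE subvv /= dY' (eqP szB).
  have szY : size (vbasis (val Y)) == (k1 + k2)%N by rewrite size_tuple dY'.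
  have [d d0 Dd] := minor_basis_change basisB (vbasisP (val Y) : basis_of _ (Tuple szY)).
  exists (c * d) => [|I cI]; first exact: mulf_neq0.
  by rewrite Dc // Dd // plucker_minor mulrA.
move=> I cI; rewrite Dc // (minor_dependent (X := Tuple szB)) ?mulr0 //.
by rewrite /free /= spanB (eqP szB).
Qed.
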